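(* Let $\mathbb{F}$ be a field and $d,r$ non-negative integers. If an $\mathbb{F}$-representable matroid $M$ has a rooted $(d,r)$-decomposition, then there exists an $\mathbb{F}$-representable matroid $N$ such that $M$ is a minor of $N$ and $\mathrm{cdd}(N)\le 2r\cdot(4^d-1)+1$.
   Context: For a matroid $M$ with rank function $r_M$ and disjoint sets $X,Y$ of elements, $\lambda_M(X,Y)=r_M(X)+r_M(Y)-r_M(X\cup Y)$. For pairwise disjoint sets $X_1,\dots,X_k$ of elements, $\lambda^*_M(X_1,\dots,X_k)=\max_{I\subseteq[k]}\lambda_M\big(\bigcup_{i\in I}X_i,\bigcup_{i\in[k]\setminus I}X_i\big)$. A rooted $(d,r)$-decomposition of $M$ is a rooted tree $T$ of depth $d$ (the depth being the maximum number of edges on a path from the root to a leaf) whose leaves are in one-to-one correspondence with the elements of $M$, such that for every inner vertex $v$ of $T$ with $k$ children, if $X_1,\dots,X_k$ are the sets of elements of $M$ assigned to the leaves of the $k$ subtrees rooted at the children of $v$, then $\lambda^*_M(X_1,\dots,X_k)\le r$. The contraction-deletion-depth $\mathrm{cdd}(M)$ is defined recursively: if $M$ has a single element, $\mathrm{cdd}(M)=1$; if $M$ is not connected, $\mathrm{cdd}(M)$ is the maximum of $\mathrm{cdd}$ over the components of $M$ (restrictions of $M$ to its components, a component being an inclusion-wise maximal set of elements any two of which lie in a common circuit); otherwise $\mathrm{cdd}(M)=1+\min_{e}\min\{\mathrm{cdd}(M/e),\mathrm{cdd}(M\setminus e)\}$, the minimum over elements $e$ of $M$. *)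

(* Defs.v *)
From HB Require Import structures.
From mathcomp Require Import all_boot all_order all_algebra.
Set Implicit Arguments. Unset Strict Implicit. Unset Printing Implicit Defensive.
Import GRing.Theory.

Record matroid (E : finType) := Matroid {
  rk : {set E} -> nat;
  rk_card : forall X, rk X <= #|X|;
  rk_mono : forall X Y : {set E}, X \subset Y -> rk X <= rk Y;
  rk_submod : forall X Y : {set E}, rk (X :|: Y) + rk (X :&: Y) <= rk X + rk Y
}.

Definition representable (F : fieldType) (E : finType) (M : matroid E) : Prop :=
  exists (n : nat) (v : E -> 'rV[F]_n),
    forall X : {set E}, rk M X = \rank (\sum_(e in X) <<v e>>)%MS.

(* M is (isomorphic to) a minor of N: M = (N / C) \ D restricted to the image
   of an injection f, i.e. r_M(X) = r_N(f X u C) - r_N(C). *)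
Definition minor (E E' : finType) (M : matroid E) (N : matroid E') : Prop :=
  exists (f : E -> E') (C : {set E'}),
    injective f /\ [disjoint (f @: [set: E]) & C] /\
    forall X : {set E}, rk M X = rk N (f @: X :|: C) - rk N C.

Definition lam (E : finType) (M : matroid E) (X Y : {set E}) : nat :=
  rk M X + rk M Y - rk M (X :|: Y).

Definition lamstar (E : finType) (M : matroid E) (Xs : seq {set E}) : nat :=
  \max_(I : {set 'I_(size Xs)})
     lam M (\bigcup_(i in I) nth set0 Xs i) (\bigcup_(i in ~: I) nth set0 Xs i).

Inductive dtree (E : Type) := Leaf of E | Node of seq (dtree E).
Arguments Leaf {E}. Arguments Node {E}.

Fixpoint leaves (E : Type) (t : dtree E) : seq E :=
  match t with Leaf e => [:: e] | Node ts => flatten (map (@leaves E) ts) end.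

Fixpoint depth (E : Type) (t : dtree E) : nat :=
  match t with Leaf _ => 0 | Node ts => (foldr maxn 0 (map (@depth E) ts)).+1 end.

Fixpoint good_vertices (E : finType) (M : matroid E) (r : nat) (t : dtree E) : bool :=
  match t with
  | Leaf _ => true
  | Node ts =>
      [&& 0 < size ts,
          lamstar M [seq [set x in leaves u] | u <- ts] <= r
        & all (good_vertices M r) ts]
  end.

Definition rooted_decomposition (E : finType) (M : matroid E) (d r : nat)
    (t : dtree E) : Prop :=
  [/\ depth t = d,
      perm_eq (leaves t) (enum E)
    & good_vertices M r t].

Definition has_rooted_decomposition (E : finType) (M : matroid E) (d r : nat) : Prop :=
  exists t : dtree E, rooted_decomposition M d r t.

(* A matroid on ground set S : {set T} with rank function rk (restricted to
   subsets of S); deletion keeps rk and shrinks S; contraction of e uses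
   rk' X = rk (X u {e}) - rk {e}. *)
Section CDD.
Variable T : finType.

Definition circuit (rkf : {set T} -> nat) (S C : {set T}) : bool :=
  [&& C \subset S, rkf C < #|C| & [forall x in C, rkf (C :\ x) == #|C :\ x|]].

Definition related (rkf : {set T} -> nat) (S : {set T}) (e f : T) : bool :=
  (e == f) || [exists C, circuit rkf S C && (e \in C) && (f \in C)].

Definition components (rkf : {set T} -> nat) (S : {set T}) : {set {set T}} :=
  [set C | maxset (fun C : {set T} => (C \subset S) &&
              [forall e in C, forall f in C, related rkf S e f]) C].

Definition contract (rkf : {set T} -> nat) (e : T) : {set T} -> nat :=
  fun X => rkf (X :|: [set e]) - rkf [set e].

(* fuel n >= #|S| guarantees that the recursion is never cut short *)
Fixpoint cdd_f (n : nat) (rkf : {set T} -> nat) (S : {set T}) : nat :=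
  match n with
  | 0 => 0
  | n'.+1 =>
    if #|S| == 0 then 0 else
    if #|S| == 1 then 1 else
    if 1 < #|components rkf S| then
      \max_(C in components rkf S) cdd_f n' rkf C
    else
      let vals := [seq minn (cdd_f n' (contract rkf e) (S :\ e))
                            (cdd_f n' rkf (S :\ e)) | e <- enum S] in
      (foldr minn (head 0 vals) vals).+1
  end.
End CDD.

Definition cdd (E : finType) (M : matroid E) : nat :=
  cdd_f #|E| (rk M) [set: E].

(* Main.v *)
Require Import Defs.
From mathcomp Require Import all_boot all_order all_algebra zify.
Set Implicit Arguments.
Unset Strict Implicit.
Unset Printing Implicit Defensive.

(** Let [V_1], ..., [V_k] be the spans of the parts at the root of the tree, so
    that [V_I] and [V_J] meet in dimension at most [r] for every bipartition
    [(I, J)] of the parts.  Inserting the parts one by one, each on the side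
    where it increases the dimension of this intersection more, yields a
    subspace [K] of dimension at most [2r] that contains [V_i :&: V_{>i}] for
    all [i].  Projecting [V_i] onto a complement of [V_i :&: V_{>i}] moves every
    vector by an element of [K], makes the parts independent and raises the
    connectivity inside each part by at most [2r].  Moving vectors by multiples
    of a single vector costs two steps: in a suitable lift one element is
    deleted and one is contracted.  Hence a decomposition of depth [d] and
    width [r] costs [4r] steps plus the cost of depth [d - 1] and width
    [3r <= 4r], and [4r + 8r(4^(d-1) - 1) <= 2r(4^d - 1)]. *)

(** * Circuits and components *)

(** [cdd_f] recurses on bare functions, so the rank axioms are attached to these; contraction
    preserves them. *)
Record is_rank (T : finType) (rkf : {set T} -> nat) : Prop := IsRank {
  rank_le_card : forall X, rkf X <= #|X|;
  rank_mono : forall X Y : {set T}, X \subset Y -> rkf X <= rkf Y;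
  rank_submod : forall X Y : {set T},
    rkf (X :|: Y) + rkf (X :&: Y) <= rkf X + rkf Y }.

Lemma matroid_is_rank (T : finType) (M : matroid T) : is_rank (rk M).
Proof. by split; [exact: rk_card | exact: rk_mono | exact: rk_submod]. Qed.

Lemma setUDK (T : finType) (X Y : {set T}) : X \subset Y -> X :|: Y :\: X = Y.
Proof. by move=> sXY; rewrite -{2}(setID Y X) (setIidPr sXY). Qed.

Section Circuits.
Variables (T : finType) (rkf : {set T} -> nat).
Hypothesis rkP : is_rank rkf.
Implicit Types (X Y Z S C D : {set T}) (e f g x : T).

Lemma rank_setU X Y : rkf (X :|: Y) <= rkf X + rkf Y.
Proof. by apply: leq_trans (rank_submod rkP X Y); rewrite leq_addr. Qed.

Lemma contract_is_rank e : is_rank (contract rkf e).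
Proof.
split=> [X | X Y sXY | X Y]; rewrite /contract.
- have := rank_setU X [set e]; have := rank_le_card rkP X; lia.
- by apply: leq_sub2r; apply: (rank_mono rkP); apply: setSU.
- have mono Z : rkf [set e] <= rkf (Z :|: [set e]).
    by apply: (rank_mono rkP); apply: subsetUr.
  have := rank_submod rkP (X :|: [set e]) (Y :|: [set e]).
  rewrite -setUUl -setUIl.
  have := mono X; have := mono Y; have := mono (X :|: Y); have := mono (X :&: Y); lia.
Qed.

Lemma independent_sub X Y : X \subset Y -> rkf Y = #|Y| -> rkf X = #|X|.
Proof.
move=> sXY iY; have := rank_le_card rkP X; have := rank_setU X (Y :\: X).
have := rank_le_card rkP (Y :\: X); rewrite cardsDS // setUDK //.
have := subset_leq_card sXY; lia.
Qed.

(** [rkf (e |: X) = rkf X] encodes that [e] lies in the closure of [X]; submodularity for [e |: X]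
    and [Y] passes this on to [Y]. *)
Lemma closure_mono e X Y :
  X \subset Y -> rkf (e |: X) = rkf X -> rkf (e |: Y) = rkf Y.
Proof.
move=> sXY eX; have := rank_submod rkP (e |: X) Y.
have ->: (e |: X) :|: Y = e |: Y by rewrite -setUA (setUidPr sXY).
have : rkf X <= rkf ((e |: X) :&: Y).
  by apply: (rank_mono rkP); rewrite subsetI subsetUr.
have : rkf Y <= rkf (e |: Y) by apply: (rank_mono rkP); apply: subsetUr.
lia.
Qed.

Lemma circuit_sub S C : circuit rkf S C -> C \subset S.
Proof. by case/and3P. Qed.

Lemma circuit_dep S C : circuit rkf S C -> rkf C < #|C|.
Proof. by case/and3P. Qed.

Lemma circuit_indep S C x : circuit rkf S C -> x \in C -> rkf (C :\ x) = #|C :\ x|.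
Proof. by case/and3P=> _ _ /forall_inP h /h /eqP. Qed.

Lemma circuit_indep_proper S C D :
  circuit rkf S C -> D \proper C -> rkf D = #|D|.
Proof.
move=> cC /properP [sDC [x xC xD]]; apply: independent_sub (circuit_indep cC xC).
by apply/subsetP=> z zD; rewrite !inE (subsetP sDC) // andbT; apply: contraNneq xD => <-.
Qed.

Lemma circuit_closure S C x :
  circuit rkf S C -> x \in C -> rkf (x |: (C :\ x)) = rkf (C :\ x).
Proof.
move=> cC xC; rewrite setD1K //; have := circuit_dep cC.
have := circuit_indep cC xC; have := rank_mono rkP (subD1set C x).
rewrite (cardsD1 x C) xC; lia.
Qed.

Lemma circuit_exists S X :
  X \subset S -> rkf X < #|X| -> exists2 C : {set T}, circuit rkf S C & C \subset X.
Proof.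
move=> sXS dX; pose P := fun C : {set T} => rkf C < #|C|.
have [C /minsetP [dC minC] sCX] := @minset_exists _ P X dX.
exists C => //; apply/and3P; split=> //; first exact: subset_trans sXS.
apply/forall_inP=> x xC; rewrite eqn_leq (rank_le_card rkP) leqNgt /=.
apply/negP=> dCx; have := minC _ dCx (subD1set C x).
by move/setP/(_ x); rewrite !inE eqxx xC.
Qed.

(** A minimal subset of full rank is independent: an element of a circuit in it could be dropped
    without loss of rank. *)
Lemma basis_exists X : exists2 Z : {set T}, Z \subset X & rkf Z = rkf X /\ rkf Z = #|Z|.
Proof.
pose P := fun Z : {set T} => rkf Z == rkf X.
have [Z /minsetP [/eqP rZ minZ] sZX] := @minset_exists _ P X (eqxx _).
exists Z => //; split=> //; apply/eqP; rewrite eqn_leq (rank_le_card rkP) leqNgt /=.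
apply/negP=> /(circuit_exists (subxx Z)) [C cC sCZ].
have [x xC] : exists x, x \in C.
  by apply/set0Pn; apply: contraTneq (circuit_dep cC) => ->; rewrite cards0.
have := minZ (Z :\ x); rewrite /P -rZ subD1set => h.
have eqr : rkf (Z :\ x) = rkf Z.
  by rewrite -(closure_mono (setSD [set x] sCZ) (circuit_closure cC xC)) setD1K ?(subsetP sCZ).
by move/setP: (h (introT eqP eqr) isT) => /(_ x); rewrite !inE eqxx (subsetP sCZ).
Qed.

(** For a basis [Z] of [Y] the set [e |: Z] is dependent, and a circuit in it must use [e], as [Z]
    is independent. *)
Lemma circuit_through S Y e :
  e |: Y \subset S -> e \notin Y -> rkf (e |: Y) = rkf Y ->
  exists C, [/\ circuit rkf S C, e \in C & C \subset e |: Y].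
Proof.
move=> sYS eY clY; have [Z sZY [rZ iZ]] := basis_exists Y.
have eZ : e \notin Z by apply: contra eY; apply: subsetP.
have sZ : e |: Z \subset e |: Y by apply: setUS.
have [|C cC sC] := circuit_exists (subset_trans sZ sYS).
  by have := rank_mono rkP sZ; rewrite cardsU1 eZ; lia.
exists C; split=> //; last exact: subset_trans sZ.
apply: contraTT (circuit_dep cC) => eC; rewrite -leqNgt (@independent_sub C Z) //.
apply/subsetP=> z zC; have := subsetP sC z zC; rewrite !inE => /predU1P [ze|//].
by rewrite -ze zC in eC.
Qed.

(** Strong circuit elimination by closures: [f] is in the closure of [C2 :\ f] and [e] in that of
    [C1 :\ e], so [e] is already in the closure of the union without [e] and [f]. *)
Lemma circuit_elimination S C1 C2 e f :
  circuit rkf S C1 -> circuit rkf S C2 -> f \in C1 :&: C2 -> e \in C1 :\: C2 ->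
  exists C, [/\ circuit rkf S C, e \in C & C \subset (C1 :|: C2) :\ f].
Proof.
move=> c1 c2 /setIP [f1 f2] /setDP [e1 e2].
have nef : e != f by apply: contraNneq e2 => ->.
pose Y := (C1 :|: C2) :\ f :\ e.
have eYf : e |: Y = (C1 :|: C2) :\ f by rewrite setD1K // !inE nef e1.
have clf : rkf (f |: Y) = rkf Y.
  apply: closure_mono (circuit_closure c2 f2).
  apply/subsetP=> z; rewrite !inE => /andP [-> z2]; rewrite z2 orbT !andbT.
  by apply: contraNneq e2 => <-.
have cle : rkf (e |: (f |: Y)) = rkf (f |: Y).
  apply: closure_mono (circuit_closure c1 e1).
  by apply/subsetP=> z; rewrite !inE => /andP [-> ->]; case: (z == f).
rewrite -eYf; apply: circuit_through.
- rewrite eYf; apply: subset_trans (subD1set _ _) _.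
  by rewrite subUset (circuit_sub c1) (circuit_sub c2).
- by rewrite !inE eqxx.
- apply/eqP; rewrite eqn_leq (rank_mono rkP (subsetUr _ _)) andbT -clf -cle.
  by apply: (rank_mono rkP); rewrite setUS // subsetUr.
Qed.

(** The core of transitivity of [related], by induction on [#|C1 :|: C2|]. With [f] in both
    circuits, elimination gives [C3] through [e] and [C4] through [g], both avoiding [f]. Take [z]
    in [C3] outside [C1]. If [z] is in [C4], the pair [C3], [C4] has a smaller union, without [f];
    otherwise the pair [C1], [C4] has one, without [z]. *)
Lemma circuit_chain S C1 C2 e g :
  circuit rkf S C1 -> circuit rkf S C2 -> e \in C1 -> g \in C2 ->
  C1 :&: C2 != set0 -> exists C, [/\ circuit rkf S C, e \in C & g \in C].
Proof.
move: {2}(#|C1 :|: C2|).+1 (ltnSn #|C1 :|: C2|) => n.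
elim: n C1 C2 => // n IHn C1 C2 ltn c1 c2 e1 g2 ne.
have [e2|e2] := boolP (e \in C2); first by exists C2.
have [g1|g1] := boolP (g \in C1); first by exists C1.
have [f f12] := set0Pn _ ne; have /setIP [f1 f2] := f12.
have [|C3 [c3 e3 s3]] := circuit_elimination c1 c2 f12 (e := e);
  first by rewrite inE e1 e2.
have [||C4 [c4 g4 s4]] := circuit_elimination c2 c1 (f := f) (e := g).
- by rewrite inE f1 f2.
- by rewrite inE g1 g2.
rewrite setUC in s4.
have smaller D1 D2 : D1 :|: D2 \proper C1 :|: C2 -> #|D1 :|: D2| < n.
  by move/proper_card => h; apply: leq_trans h _.
(* A circuit inside [D' :|: D''] that avoids [x \in D'] is not contained in [D'], since proper
   subsets of a circuit are independent. *)
have meets D D' D'' x : circuit rkf S D -> circuit rkf S D' -> x \in D' ->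
    D \subset (D' :|: D'') :\ x -> exists2 z, z \in D & z \in D'' :\: D'.
  move=> cD cD' xD' sD; have : ~~ (D \subset D').
    apply/negP=> sDD'; have pD : D \proper D'.
      by apply/properP; split=> //; exists x => //; apply/negP=> /(subsetP sD);
        rewrite !inE eqxx.
    by have := circuit_dep cD; rewrite (circuit_indep_proper cD' pD) ltnn.
  case/subsetPn=> z zD zD'; exists z => //; have := subsetP sD z zD.
  by rewrite !inE (negPf zD') /= => /andP [].
have [z z3 /setDP [z2 z1]] := meets _ _ _ _ c3 c1 f1 s3.
have [z4|z4] := boolP (z \in C4).
  apply: (IHn C3 C4) => //; last by apply/set0Pn; exists z; rewrite inE z3.
  apply: smaller; apply/properP; split; last first.
    exists f; first by rewrite inE f1.
    by apply/negP=> /setUP [/(subsetP s3)|/(subsetP s4)]; rewrite !inE eqxx.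
  by apply: (@subset_trans _ _ (mem ((C1 :|: C2) :\ f)));
    rewrite ?subD1set // subUset s3 s4.
have [y y4 /setDP [y1 y2]] : exists2 y, y \in C4 & y \in C1 :\: C2.
  by apply: (meets _ _ _ _ c4 c2 f2); rewrite setUC.
apply: (IHn C1 C4) => //; last by apply/set0Pn; exists y; rewrite inE y1.
apply: smaller; apply/properP; split; last first.
  by exists z; rewrite inE ?z2 ?orbT // negb_or z1.
by rewrite subUset subsetUl; apply: subset_trans s4 (subD1set _ _).
Qed.

Lemma related_sym S : symmetric (related rkf S).
Proof.
by move=> e f; rewrite /related eq_sym; congr (_ || _); apply: eq_existsb => C;
  rewrite andbAC.
Qed.

Lemma related_trans S : transitive (related rkf S).
Proof.
move=> f e g /predU1P [->//|/existsP [C1 /andP [/andP [c1 e1] f1]]].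
case/predU1P=> [<-|/existsP [C2 /andP [/andP [c2 f2] g2]]].
  by apply/orP; right; apply/existsP; exists C1; rewrite c1 e1.
have [|C [cC eC gC]] := circuit_chain c1 c2 e1 g2.
  by apply/set0Pn; exists f; rewrite inE f1.
by apply/orP; right; apply/existsP; exists C; rewrite cC eC.
Qed.

(** By transitivity [C :|: D] is again pairwise related, so maximality of [C] absorbs [D]. *)
Lemma component_circuit S C D :
  C \in components rkf S -> circuit rkf S D -> D :&: C != set0 -> D \subset C.
Proof.
rewrite inE => /maxsetP [/andP [sCS relC] maxC] cD /set0Pn [x /setIP [xD xC]].
have relx z : z \in C :|: D -> related rkf S x z.
  case/setUP=> [zC|zD].
    by have /forall_inP/(_ _ xC)/forall_inP/(_ _ zC) := relC.
  by apply/orP; right; apply/existsP; exists D; rewrite cD xD.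
suff <-: C :|: D = C by apply: subsetUr.
apply: maxC; last exact: subsetUl.
rewrite subUset sCS (circuit_sub cD) /=.
apply/forall_inP=> e /relx re; apply/forall_inP=> f /relx rf.
by apply: (related_trans _ rf); rewrite related_sym.
Qed.

(** Bases of [C] and of [S :\: C] have an independent union: a circuit in it would lie in one of the
    two bases by [component_circuit]. *)
Lemma component_separator S C :
  C \in components rkf S -> rkf C + rkf (S :\: C) = rkf S.
Proof.
move=> cC; have sCS : C \subset S by move: cC; rewrite inE => /maxsetp /andP [].
apply/eqP; rewrite eqn_leq andbC -{1}(setUDK sCS) rank_setU /=.
have [B1 s1 [<- i1]] := basis_exists C; have [B2 s2 [<- i2]] := basis_exists (S :\: C).
have dis : B1 :&: B2 = set0.
  apply/setP=> z; rewrite !inE; apply/negP=> /andP [/(subsetP s1) zC /(subsetP s2)].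
  by rewrite inE zC.
have sB : B1 :|: B2 \subset S by rewrite -(setUDK sCS) setUSS.
suff iB : rkf (B1 :|: B2) = #|B1 :|: B2|.
  by rewrite i1 i2 -cardsUI dis cards0 addn0 -iB (rank_mono rkP).
apply/eqP; rewrite eqn_leq (rank_le_card rkP) leqNgt /=; apply/negP.
case/(circuit_exists sB)=> D cD sD; have := circuit_dep cD; apply/negP; rewrite -leqNgt.
have [D0|/(component_circuit cC cD) sDC] := eqVneq (D :&: C) set0.
  rewrite (@independent_sub D B2) //; apply/subsetP=> z zD.
  case/setUP: (subsetP sD z zD) => // /(subsetP s1) zC.
  by move/setP/(_ z): D0; rewrite !inE zD zC.
rewrite (@independent_sub D B1) //; apply/subsetP=> z zD.
case/setUP: (subsetP sD z zD) => // /(subsetP s2).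
by rewrite inE (subsetP sDC).
Qed.

Lemma component_exists S e :
  e \in S -> exists2 C : {set T}, C \in components rkf S & e \in C.
Proof.
move=> eS; pose P := fun C : {set T} => (C \subset S) &&
  [forall e in C, forall f in C, related rkf S e f].
have [|C maxC sC] := @maxset_exists _ P [set e].
  rewrite /P sub1set eS /=; apply/forall_inP=> x /set1P ->;
    apply/forall_inP=> y /set1P ->.
  by rewrite /related eqxx.
by exists C; rewrite ?inE // -sub1set.
Qed.

Lemma component_proper S C :
  1 < #|components rkf S| -> C \in components rkf S -> C \proper S.
Proof.
move=> lt1 cC; have := cC; rewrite inE => /maxsetP [/andP [sCS relC] _].
rewrite properEneq sCS andbT; apply: contraTneq lt1 => eCS; rewrite -leqNgt.
apply/card_le1_eqP=> D1 D2; suff all_eq D : D \in components rkf S -> D = C.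
  by move=> /all_eq -> /all_eq ->.
rewrite inE => /maxsetP [/andP [sDS _] maxD]; rewrite (maxD C) ?sCS //.
by rewrite eCS.
Qed.

(** Add the submodular inequalities for the pairs [Z], [S'] and [Z :|: S'], [S :\: S']; the rank of
    [Z :|: S'] cancels, and so do the ranks in the separator equation. *)
Lemma separator_restrict S S' Z :
  S' \subset S -> rkf S' + rkf (S :\: S') = rkf S -> Z \subset S ->
  rkf (Z :&: S') + rkf (Z :\: S') = rkf Z.
Proof.
move=> sS' sepS' sZ; apply/eqP; rewrite eqn_leq andbC -{1}(setID Z S') rank_setU /=.
have := rank_submod rkP Z S'; have := rank_submod rkP (Z :|: S') (S :\: S').
have ->: (Z :|: S') :|: S :\: S' = S by rewrite -setUA setUDK // (setUidPr sZ).
have ->: (Z :|: S') :&: (S :\: S') = Z :\: S'; last by lia.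
apply/setP=> z; rewrite !inE; case: (z \in S'); rewrite ?orbF ?andbF //=.
by case: (boolP (z \in Z)) => // /(subsetP sZ) ->.
Qed.

(** A circuit with elements on both sides is cut into two independent sets whose ranks add up, which
    would make it independent. *)
Lemma related_separator S S' e f :
  S' \subset S -> rkf S' + rkf (S :\: S') = rkf S ->
  e \in S' -> f \in S :\: S' -> ~~ related rkf S e f.
Proof.
move=> sS' sepS' eS' /setDP [fS fS'].
apply/negP=> /predU1P [ef|/existsP [D /andP [/andP [cD eD] fD]]].
  by rewrite -ef eS' in fS'.
have := circuit_dep cD; rewrite -(separator_restrict sS' sepS' (circuit_sub cD)).
rewrite (@circuit_indep_proper S D (D :&: S')) //; last first.
  by apply/properP; split; [exact: subsetIl | exists f => //; rewrite !inE fD].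
rewrite (@circuit_indep_proper S D (D :\: S')) //; first by rewrite cardsID ltnn.
by apply/properP; split; [exact: subsetDl | exists e => //; rewrite !inE eS'].
Qed.

End Circuits.

(** * Upper bounds for the contraction-deletion-depth *)

(* An upper bound for [cdd] by certificates; unlike in the definition of
   [cdd_f], a deletion or contraction is allowed in a disconnected matroid. *)
Inductive cdd_le (T : finType) : nat -> ({set T} -> nat) -> {set T} -> Prop :=
| cdd_le_small k rkf (S : {set T}) : 0 < k -> #|S| <= 1 -> cdd_le k rkf S
| cdd_le_sum k rkf (S S' : {set T}) : S' \subset S -> rkf S' + rkf (S :\: S') = rkf S ->
    cdd_le k rkf S' -> cdd_le k rkf (S :\: S') -> cdd_le k rkf S
| cdd_le_del k rkf (S : {set T}) e : e \in S ->
    cdd_le k rkf (S :\ e) -> cdd_le k.+1 rkf S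
| cdd_le_con k rkf (S : {set T}) e : e \in S ->
    cdd_le k (contract rkf e) (S :\ e) -> cdd_le k.+1 rkf S.

Lemma cdd_le_pos (T : finType) k rkf (S : {set T}) : cdd_le k rkf S -> 0 < k.
Proof. by elim. Qed.

Lemma cdd_le_weaken (T : finType) k l rkf (S : {set T}) :
  k <= l -> cdd_le k rkf S -> cdd_le l rkf S.
Proof.
move=> lekl leS; elim: leS l lekl => {k rkf S}
  [k rkf S k0 S1|k rkf S S' sS' sepS' _ IH1 _ IH2|k rkf S e eS _ IH
    |k rkf S e eS _ IH] l lekl.
- by apply: cdd_le_small => //; apply: leq_trans lekl.
- by apply: (cdd_le_sum sS' sepS'); [apply: IH1 | apply: IH2].
- by case: l lekl => // l lekl; apply: (cdd_le_del eS); apply: IH.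
- by case: l lekl => // l lekl; apply: (cdd_le_con eS); apply: IH.
Qed.

Lemma cdd_le_imset (T T' : finType) (h : T -> T') k rkf rkf' (S : {set T}) :
  injective h -> (forall X : {set T}, X \subset S -> rkf' (h @: X) = rkf X) ->
  cdd_le k rkf S -> cdd_le k rkf' (h @: S).
Proof.
move=> inj_h + leS.
have imD (A B : {set T}) : h @: (A :\: B) = h @: A :\: h @: B.
  apply/setP=> z; rewrite !inE; apply/imsetP/andP.
    by case=> x /setDP [xA xB] ->; rewrite !mem_imset.
  by case=> zB /imsetP [x xA ez]; exists x => //;
    rewrite inE xA andbT -(mem_imset _ _ inj_h) -ez.
elim: leS rkf' => {k rkf S}
  [k rkf S k0 S1|k rkf S S' sS' sepS' _ IH1 _ IH2|k rkf S e eS _ IH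
    |k rkf S e eS _ IH] rkf' eqr.
- by apply: cdd_le_small => //; rewrite card_imset.
- have sD : S :\: S' \subset S by apply: subsetDl.
  apply: (@cdd_le_sum _ _ _ _ (h @: S')); rewrite -?imD.
  + exact: imsetS.
  + by rewrite !eqr.
  + by apply: IH1 => X sX; apply: eqr; apply: subset_trans sS'.
  + by apply: IH2 => X sX; apply: eqr; apply: subset_trans sD.
- apply: (@cdd_le_del _ _ _ _ (h e)); first by rewrite mem_imset.
  rewrite -imset_set1 -imD; apply: IH => X sX; apply: eqr.
  exact: subset_trans sX (subD1set _ _).
- apply: (@cdd_le_con _ _ _ _ (h e)); first by rewrite mem_imset.
  rewrite -imset_set1 -imD; apply: IH => X sX;
    rewrite /contract -imset_set1 -imsetU !eqr //.
    by rewrite sub1set.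
  by rewrite subUset sub1set eS andbT; apply: subset_trans sX (subD1set _ _).
Qed.

Lemma cdd_le_eq (T : finType) k rkf rkf' (S : {set T}) :
  (forall X : {set T}, X \subset S -> rkf' X = rkf X) ->
  cdd_le k rkf S -> cdd_le k rkf' S.
Proof.
move=> eqr leS; rewrite -(imset_id S); apply: cdd_le_imset leS => // X sX.
by rewrite imset_id eqr.
Qed.

(** Certificates may split at any separator while [cdd_f] splits into components, so bounds must
    pass to separators. The certificate is restricted to [S']; steps at an element outside [S'] are
    skipped. *)
Lemma cdd_le_separator (T : finType) k rkf (S S' : {set T}) :
  is_rank rkf -> S' \subset S -> rkf S' + rkf (S :\: S') = rkf S ->
  cdd_le k rkf S -> cdd_le k rkf S'.
Proof.
move=> + + + leS; elim: leS S' => {k rkf S}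
  [k rkf S k0 S1|k rkf S S1 sS1 sep1 _ IH1 _ IH2|k rkf S e eS _ IH
    |k rkf S e eS le_con IH] S' rkP sS' sepS'.
- by apply: cdd_le_small => //; apply: leq_trans (subset_leq_card sS') S1.
- have eI : S' :\: (S' :&: S1) = S' :&: (S :\: S1).
    by apply/setP=> z; rewrite !inE; case: (boolP (z \in S')) => // /(subsetP sS') ->;
      rewrite andbT.
  apply: (@cdd_le_sum _ _ _ _ (S' :&: S1)); first exact: subsetIl.
  + by rewrite setDIr setDv set0U; apply: (separator_restrict rkP sS1).
  + apply: IH1 => //; first exact: subsetIr.
    rewrite setDIr setDv setU0 [S' :&: _]setIC.
    exact: (separator_restrict rkP sS').
  + rewrite eI; apply: IH2 => //; first exact: subsetIr.
    rewrite setDIr setDv setU0 [S' :&: _]setIC.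
    by apply: (separator_restrict rkP sS') => //; apply: subsetDl.
- have sD := subD1set S e; have := separator_restrict rkP sS' sepS' sD.
  have ->: (S :\ e) :&: S' = S' :\ e.
    by apply/setP=> z; rewrite !inE; case: (boolP (z \in S')) => [/(subsetP sS') ->|];
      rewrite ?andbT ?andbF.
  have ->: (S :\ e) :\: S' = (S :\ e) :\: (S' :\ e).
    by apply/setP=> z; rewrite !inE; case: (z == e); rewrite /= ?andbF.
  move=> sep; have leD : cdd_le k rkf (S' :\ e) by apply: IH => //; apply: setSD.
  have [eS'|eS'] := boolP (e \in S'); first exact: cdd_le_del eS' leD.
  have /setDidPl eD : [disjoint S' & [set e]] by rewrite disjoint_sym disjoints1.
  by move: leD; rewrite eD; apply: cdd_le_weaken.
- have rkP' := contract_is_rank rkP e.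
  have [eS'|eS'] := boolP (e \in S').
    apply: (cdd_le_con eS'); apply: IH => //; first exact: setSD.
    have eU (Z : {set T}) : e \in Z -> (Z :\ e) :|: [set e] = Z by move=> eZ;
      rewrite setUC setD1K.
    have eD : (S :\ e) :\: (S' :\ e) = S :\: S'.
      by apply/setP=> z; rewrite !inE; case: eqP => [->|]; rewrite ?eS' ?andbF.
    rewrite /contract !eU // eD.
    have sZ : S :\: S' :|: [set e] \subset S by rewrite subUset subsetDl sub1set.
    have := separator_restrict rkP sS' sepS' sZ.
    have ->: (S :\: S' :|: [set e]) :&: S' = [set e].
      apply/setP=> z; rewrite !inE; case: eqP => [->|]; rewrite ?eS' ?orbT //= orbF.
      by case: (z \in S'); rewrite ?andbF.
    have ->: (S :\: S' :|: [set e]) :\: S' = S :\: S'.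
      by apply/setP=> z; rewrite !inE; case: eqP => [->|]; rewrite ?eS' ?orbF //=;
        case: (z \in S').
    have := rank_mono rkP (_ : [set e] \subset S'); rewrite sub1set => /(_ eS'); lia.
  (* Ranks add over [X] and [[set e]], which lie on different sides of the separator, so contracting
     [e] is invisible inside [S']. *)
  have eqc (X : {set T}) : X \subset S' -> rkf X = contract rkf e X.
    move=> sX; have sZ : X :|: [set e] \subset S by rewrite subUset (subset_trans sX) // sub1set.
    have := separator_restrict rkP sS' sepS' sZ; rewrite /contract.
    have ->: (X :|: [set e]) :&: S' = X.
      apply/setP=> z; rewrite !inE; case: eqP => [->|]; rewrite ?orbF.
        by rewrite (negPf eS') andbF; apply/esym/negP=> /(subsetP sX); apply/negP.
      by case: (boolP (z \in X)) => // /(subsetP sX) ->.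
    have ->: (X :|: [set e]) :\: S' = [set e]; last by lia.
    apply/setP=> z; rewrite !inE; case: eqP => [->|]; rewrite ?orbF ?orbT ?(negPf eS') //.
    by case: (boolP (z \in X)) => [/(subsetP sX) ->|]; rewrite ?andbF.
  apply: (cdd_le_weaken (leqnSn k)); apply: (cdd_le_eq eqc); apply: IH => //.
    by rewrite subsetD1 sS'.
  rewrite -(eqc _ (subxx _)).
  have ->: contract rkf e ((S :\ e) :\: S') = rkf (S :\: S') - rkf [set e].
    rewrite /contract; congr (rkf _ - _).
    by apply/setP=> z; rewrite !inE; case: eqP => [->|]; rewrite ?eS' ?eS ?orbF.
  rewrite /contract setUC setD1K //.
  have := rank_mono rkP (_ : [set e] \subset S :\: S').
  by rewrite sub1set !inE eS' eS => /(_ isT); lia.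
Qed.

Lemma foldr_minn_le (s : seq nat) x a : x \in s -> foldr minn a s <= x.
Proof.
elim: s => //= y s IHs; rewrite inE => /predU1P [->|/IHs]; first exact: geq_minl.
by apply: leq_trans; apply: geq_minr.
Qed.

(** The outer induction is on the fuel; running out of it returns 0, which respects any upper bound.
    A disconnected set is handled by its components, which are separators, and a connected one by an
    inner induction on the certificate. *)
Lemma cdd_f_le (T : finType) n k rkf (S : {set T}) :
  is_rank rkf -> cdd_le k rkf S -> cdd_f n rkf S <= k.
Proof.
elim: n k rkf S => // n IHn k rkf S rkP leS /=.
case: ifP => // S0; case: ifP => [_|S1]; first exact: cdd_le_pos leS.
case: ifP => [lt1|/negbT].
  apply/bigmax_leqP=> C cC; apply: IHn => //.
  have sCS := proper_sub (component_proper lt1 cC).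
  exact: (cdd_le_separator rkP sCS (component_separator rkP cC)).
rewrite -leqNgt => /card_le1_eqP conn.
(* The seed [head 0 vals] of the fold is harmless: the fold is at most every member of [vals]. *)
have step e c : e \in S ->
    cdd_f n (contract rkf e) (S :\ e) <= c \/ cdd_f n rkf (S :\ e) <= c ->
    let vals := [seq minn (cdd_f n (contract rkf e) (S :\ e))
                          (cdd_f n rkf (S :\ e)) | e <- enum S] in
    (foldr minn (head 0 vals) vals).+1 <= c.+1.
  move=> eS le_c /=; rewrite ltnS; set a := head _ _.
  have : minn (cdd_f n (contract rkf e) (S :\ e)) (cdd_f n rkf (S :\ e)) <= c.
    by rewrite geq_min; apply/orP.
  by apply: leq_trans; apply: foldr_minn_le; apply/mapP; exists e; rewrite ?mem_enum.
elim: leS rkP S0 S1 conn step => {k rkf S}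
  [k rkf S k0 leS1|k rkf S S' sS' sepS' le1 IH1 le2 IH2|k rkf S e eS le _
    |k rkf S e eS le _] rkP S0 S1 conn step.
- by move: leS1 S0 S1; case: #|S| => [|[]].
(* In a connected set a sum certificate has an empty side: elements of two nonempty sides would be
   unrelated, although the only component contains both. *)
- have [S'0|/set0Pn [e eS']] := eqVneq S' set0.
    by move: IH2; rewrite S'0 setD0; apply.
  have [D0|/set0Pn [f fS']] := eqVneq (S :\: S') set0.
    have eSS' : S = S' by apply/eqP; rewrite eqEsubset sS' andbT -setD_eq0 D0.
    by move: IH1; rewrite -eSS'; apply.
  have [C cC eC] := component_exists rkf (subsetP sS' _ eS').
  have [C' cC' fC'] := component_exists rkf (subsetP (subsetDl _ _) _ fS').
  have := related_separator rkP sS' sepS' eS' fS'.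
  rewrite (conn _ _ cC' cC) in eC.
  move: cC'; rewrite inE => /maxsetp /andP [_ /forall_inP/(_ _ eC)/forall_inP/(_ _ fC') ->].
  by [].
- by apply: (step e) => //; right; apply: IHn.
- by apply: (step e) => //; left; apply: IHn => //; apply: contract_is_rank.
Qed.

Lemma cdd_le_cdd (T : finType) (M : matroid T) k :
  cdd_le k (rk M) [set: T] -> cdd M <= k.
Proof. exact/cdd_f_le/matroid_is_rank. Qed.

(** * Vector configurations and their lifts *)

Import GRing.Theory.
Local Open Scope ring_scope.

Section Span.
Variable F : fieldType.

Definition row_span (E : finType) n (v : E -> 'rV[F]_n) (X : {set E}) : 'M[F]_n :=
  (\sum_(e in X) <<v e>>)%MS.

Variables (E : finType) (n : nat).
Implicit Types (v : E -> 'rV[F]_n) (X Y C : {set E}).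

Lemma row_span_subP m v X (U : 'M_(m, n)) :
  reflect (forall e, e \in X -> (v e <= U)%MS) (row_span v X <= U)%MS.
Proof. by apply: (iffP sumsmx_subP) => h e /h; rewrite genmxE. Qed.

Lemma mem_row_span v X e : e \in X -> (v e <= row_span v X)%MS.
Proof. by move: e; apply/row_span_subP. Qed.

Lemma row_spanS v X Y : X \subset Y -> (row_span v X <= row_span v Y)%MS.
Proof. by move=> sXY; apply/row_span_subP=> e /(subsetP sXY)/mem_row_span. Qed.

Lemma row_spanU v X Y : (row_span v (X :|: Y) :=: row_span v X + row_span v Y)%MS.
Proof.
apply/eqmxP; rewrite addsmx_sub !row_spanS ?subsetUl ?subsetUr // !andbT.
apply/row_span_subP=> e /setUP [] eX; apply: submx_trans (mem_row_span v eX) _.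
  exact: addsmxSl.
exact: addsmxSr.
Qed.

Lemma row_span0 v : row_span v set0 = 0.
Proof. by rewrite /row_span big_set0. Qed.

Lemma row_span1 v e : (row_span v [set e] :=: v e)%MS.
Proof. by rewrite /row_span big_set1; apply: genmxE. Qed.

Lemma eq_row_span v v' X : {in X, v =1 v'} -> row_span v X = row_span v' X.
Proof. by move=> eqv; apply: eq_bigr => e /eqv ->. Qed.

End Span.

Section SpanMap.
Variables (F : fieldType) (E : finType) (n : nat).
Implicit Types (v : E -> 'rV[F]_n) (X Y C : {set E}).

Lemma row_spanM v X m (p : 'M_(n, m)) :
  (row_span (fun e => v e *m p) X :=: row_span v X *m p)%MS.
Proof.
apply/eqmxP/andP; split.
  by apply/row_span_subP=> e eX; apply: submxMr; apply: mem_row_span.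
rewrite /row_span sumsmxMr_gen; apply/sumsmx_subP=> e eX.
by rewrite !genmxE (eqmxMr p (genmxE (v e))) (@mem_row_span _ _ _ (fun e => v e *m p)).
Qed.

Lemma row_span_rank_card v X : (\rank (row_span v X) <= #|X|)%N.
Proof.
rewrite -sum1_card; apply: leq_trans (mxrank_sum_leqif _) _ => /=.
by apply: leq_sum => e _; rewrite genmxE rank_leq_row.
Qed.

Lemma row_span_rank_submod v X Y :
  (\rank (row_span v (X :|: Y)) + \rank (row_span v (X :&: Y))
   <= \rank (row_span v X) + \rank (row_span v Y))%N.
Proof.
rewrite -(mxrank_sum_cap (row_span v X)) row_spanU leq_add2l mxrankS // sub_capmx.
by rewrite !row_spanS ?subsetIl ?subsetIr.
Qed.

Definition vector_matroid v : matroid E :=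
  Matroid (row_span_rank_card v) (fun X Y sXY => mxrankS (row_spanS v sXY))
    (row_span_rank_submod v).

(** Applying [p] represents the contraction of [C]: on the span of [X :|: C] its kernel is exactly
    the span of [C], so rank-nullity gives the difference. *)
Lemma row_span_rank_contract v X C m (p : 'M_(n, m)) :
  (row_span v C == row_span v (X :|: C) :&: kermx p)%MS ->
  (\rank (row_span v (X :|: C)) - \rank (row_span v C))%N =
  \rank (row_span (fun e => v e *m p) X).
Proof.
move=> /eqmxP eqC; rewrite -(mxrank_mul_ker (row_span v (X :|: C)) p) -eqC addnK row_spanM.
apply/eqmx_rank/andP; split; last by apply: submxMr; rewrite row_spanS ?subsetUl.
rewrite (eqmxMr p (row_spanU v X C)) addsmxMr addsmx_sub submx_refl /=.
have /sub_kermxP -> : (row_span v C <= kermx p)%MS by rewrite eqC capmxSr.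
exact: sub0mx.
Qed.

End SpanMap.

Lemma row_span_imset (F : fieldType) (E E' : finType) n (v : E' -> 'rV[F]_n)
    (h : E -> E') (X : {set E}) :
  (row_span v (h @: X) :=: row_span (v \o h) X)%MS.
Proof.
apply/eqmxP/andP; split; apply/row_span_subP=> e.
  by case/imsetP=> x xX ->; apply: (@mem_row_span _ _ _ (v \o h) _ x).
by move=> eX /=; apply: mem_row_span; apply: imset_f.
Qed.

(* The vectors [v e], [e \in S], are images of vectors [w (f e)] of a larger
   configuration under a linear map whose kernel is spanned by the vectors to
   be contracted; the remaining vectors of the configuration are deleted.
   Keeping [p] is what makes such lifts composable, since representations
   of a matroid need not be equivalent.  Recording the subspace [U]
   containing the image allows to form direct sums. *)
Variant bounded_lift (F : fieldType) (E : finType) n (v : E -> 'rV[F]_n)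
    (S : {set E}) (U : 'M[F]_n) (k : nat) : Prop :=
  BoundedLift (A : finType) m (w : A -> 'rV[F]_m) (p : 'M[F]_(m, n))
    (f : E -> A) (C : {set A}) of
    {in S &, injective f} & [disjoint f @: S & C] &
    (forall e, e \in S -> w (f e) *m p = v e) &
    (row_span w setT *m p <= U)%MS &
    (row_span w C == row_span w setT :&: kermx p)%MS &
    cdd_le k (rk (vector_matroid w)) setT.

(** * Lifts of single vectors and of direct sums *)

Section BoundedLift.
Variables (F : fieldType) (E : finType) (n : nat).
Implicit Types (v : E -> 'rV[F]_n) (S : {set E}) (U : 'M[F]_n).

Lemma bounded_lift_weaken v S U U' k k' :
  (U <= U')%MS -> (k <= k')%N -> bounded_lift v S U k -> bounded_lift v S U' k'.
Proof.
move=> sU lek [A m w p f C inj_f dis wfp wU ker_p lew].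
apply: (BoundedLift inj_f dis wfp _ ker_p); first exact: submx_trans wU sU.
exact: cdd_le_weaken lew.
Qed.

Lemma bounded_lift_set0 v k : (0 < k)%N -> bounded_lift v set0 0 k.
Proof.
move=> k0; apply: (@BoundedLift _ _ _ _ _ _ _ unit n (fun=> 0) 1%:M (fun=> tt) set0).
- by move=> e f; rewrite inE.
- by rewrite imset0 disjoints_subset sub0set.
- by move=> e; rewrite inE.
- by rewrite mulmx1; apply/row_span_subP=> *; apply: sub0mx.
- rewrite row_span0 sub0mx /=; apply: submx_trans (capmxSl _ _) _.
  by apply/row_span_subP=> *; apply: sub0mx.
- by apply: cdd_le_small; rewrite // cardsT card_unit.
Qed.

Lemma bounded_lift_set1 v e k : (0 < k)%N -> bounded_lift v [set e] (row_span v [set e]) k.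
Proof.
move=> k0; apply: (@BoundedLift _ _ _ _ _ _ _ unit n (fun=> v e) 1%:M (fun=> tt) set0).
- by move=> x y /set1P -> /set1P ->.
- by rewrite disjoint_sym disjoints_subset sub0set.
- by move=> x /set1P ->; rewrite mulmx1.
- by rewrite mulmx1; apply/row_span_subP=> _ _; apply: mem_row_span; rewrite inE.
- rewrite row_span0 sub0mx; apply/rV_subP=> u; rewrite sub_capmx => /andP [_ /sub_kermxP].
  by rewrite mulmx1 => ->; apply: sub0mx.
- by apply: cdd_le_small; rewrite // cardsT card_unit.
Qed.

(** The two configurations are placed in complementary coordinate blocks, so their matroids form a
    direct sum. Their images under [p1] and [p2] meet in 0 because [U1] and [U2] do, hence the
    kernel of the joint map on the span is the sum of the two kernels. *)
Lemma bounded_lift_sum v S1 S2 U1 U2 k :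
  [disjoint S1 & S2] -> (U1 :&: U2)%MS = 0 ->
  bounded_lift v S1 U1 k -> bounded_lift v S2 U2 k ->
  bounded_lift v (S1 :|: S2) (U1 + U2)%MS k.
Proof.
move=> disS capU [A1 m1 w1 p1 f1 C1 inj1 dis1 wfp1 wU1 ker1 le1].
case=> A2 m2 w2 p2 f2 C2 inj2 dis2 wfp2 wU2 ker2 le2.
pose w (a : A1 + A2) : 'rV[F]_(m1 + m2) :=
  match a with inl a => row_mx (w1 a) 0 | inr a => row_mx 0 (w2 a) end.
pose f e : A1 + A2 := if e \in S1 then inl (f1 e) else inr (f2 e).
pose i1 : 'M[F]_(m1, m1 + m2) := row_mx 1%:M 0.
pose i2 : 'M[F]_(m2, m1 + m2) := row_mx 0 1%:M.
pose q1 : 'M[F]_(m1 + m2, m1) := col_mx 1%:M 0.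
pose q2 : 'M[F]_(m1 + m2, m2) := col_mx 0 1%:M.
have iq1 : i1 *m q1 = 1%:M by rewrite mul_row_col !mulmx1 mulmx0 addr0.
have iq2 : i2 *m q2 = 1%:M by rewrite mul_row_col !mulmx1 mulmx0 add0r.
have qi u : u *m q1 *m i1 + u *m q2 *m i2 = u.
  rewrite -[u]hsubmxK !mul_row_col !mulmx1 !mulmx0 addr0 add0r.
  by rewrite !mul_mx_row !mulmx1 !mulmx0 add_row_mx addr0 add0r.
have wi1 : w \o inl =1 fun a => w1 a *m i1 by move=> a;
  rewrite /= mul_mx_row mulmx1 mulmx0.
have wi2 : w \o inr =1 fun a => w2 a *m i2 by move=> a;
  rewrite /= mul_mx_row mulmx1 mulmx0.
have span_inl (X : {set A1}) : (row_span w (inl @: X) :=: row_span w1 X *m i1)%MS.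
  by apply: eqmx_trans (row_span_imset _ _ _) _; rewrite (eq_row_span (in1W wi1));
    apply: row_spanM.
have span_inr (X : {set A2}) : (row_span w (inr @: X) :=: row_span w2 X *m i2)%MS.
  by apply: eqmx_trans (row_span_imset _ _ _) _; rewrite (eq_row_span (in1W wi2));
    apply: row_spanM.
have rank_inl (X : {set A1}) : \rank (row_span w (inl @: X)) = \rank (row_span w1 X).
  by rewrite span_inl mxrankMfree //; apply/row_freeP; exists q1.
have rank_inr (X : {set A2}) : \rank (row_span w (inr @: X)) = \rank (row_span w2 X).
  by rewrite span_inr mxrankMfree //; apply/row_freeP; exists q2.
have TD : [set: (A1 + A2)%type] :\: inl @: [set: A1] = inr @: [set: A2].
  apply/setP=> [[a|a]]; rewrite !inE /= ?andbT.
    by rewrite mem_imset ?inE; [apply/esym/negbTE/imsetP=> [[]]|move=> ? ? []].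
  by rewrite [RHS]mem_imset ?inE; [apply/imsetP=> [[]]|move=> ? ? []].
have TU : [set: (A1 + A2)%type] = inl @: [set: A1] :|: inr @: [set: A2].
  by rewrite -TD setUDK ?subsetT.
have sq1 : (row_span w setT *m q1 <= row_span w1 setT)%MS.
  rewrite -row_spanM; apply/row_span_subP=> [[a|a]] _ /=;
    rewrite mul_row_col !mulmx0 ?mulmx1 ?addr0 ?mul0mx ?sub0mx //.
  by rewrite mem_row_span ?inE.
have sq2 : (row_span w setT *m q2 <= row_span w2 setT)%MS.
  rewrite -row_spanM; apply/row_span_subP=> [[a|a]] _ /=;
    rewrite mul_row_col ?mul0mx ?mulmx0 ?mulmx1 ?add0r ?sub0mx //.
  by rewrite mem_row_span ?inE.
apply: (@BoundedLift _ _ _ _ _ _ _ _ _ w (col_mx p1 p2) f (inl @: C1 :|: inr @: C2)).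
- have mem2 e : e \in S1 :|: S2 -> e \notin S1 -> e \in S2 by rewrite inE;
  case: (e \in S1).
  move=> x y xS yS; rewrite /f; case: ifPn => x1; case: ifPn => y1 // [].
    exact: inj1.
  by apply: inj2; apply: mem2.
- rewrite disjoints_subset; apply/subsetP=> _ /imsetP [e eS ->]; rewrite inE.
  apply/negP=> /setUP; rewrite /f; case: ifPn => e1 [] /imsetP [c cC] // [efc].
    by have /disjointFr/(_ (imset_f f1 e1)) := dis1; rewrite efc cC.
  have e2 : e \in S2 by move: eS; rewrite inE (negPf e1).
  by have /disjointFr/(_ (imset_f f2 e2)) := dis2; rewrite efc cC.
- move=> e eS; rewrite /f; case: ifPn => e1 /=; rewrite mul_row_col mul0mx ?addr0 ?add0r.
    exact: wfp1.
  by apply: wfp2; move: eS; rewrite inE (negPf e1).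
- rewrite -row_spanM; apply/row_span_subP=> [[a|a]] _ /=;
  rewrite mul_row_col mul0mx ?addr0 ?add0r.
    apply: submx_trans (addsmxSl _ _); apply: submx_trans wU1; apply: submxMr.
    by rewrite mem_row_span ?inE.
  apply: submx_trans (addsmxSr _ _); apply: submx_trans wU2; apply: submxMr.
  by rewrite mem_row_span ?inE.
- apply/andP; split.
    rewrite sub_capmx row_spanS ?subsetT //=; apply/sub_kermxP/eqP.
    rewrite -submx0 -row_spanM; apply/row_span_subP=> a.
    case/setUP=> /imsetP [c cC ->] /=; rewrite mul_row_col mul0mx ?addr0 ?add0r submx0;
      apply/eqP/sub_kermxP.
      apply: submx_trans (mem_row_span w1 cC) _; rewrite (eqmxP ker1); exact: capmxSr.
    apply: submx_trans (mem_row_span w2 cC) _; rewrite (eqmxP ker2); exact: capmxSr.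
  apply/rV_subP=> u; rewrite sub_capmx => /andP [uw /sub_kermxP up].
  have u1 : (u *m q1 <= row_span w1 setT)%MS by apply: submx_trans sq1; apply: submxMr.
  have u2 : (u *m q2 <= row_span w2 setT)%MS by apply: submx_trans sq2; apply: submxMr.
  have sum0 : u *m q1 *m p1 + u *m q2 *m p2 = 0.
    rewrite -up -[in RHS](qi _ u) mulmxDl -!mulmxA.
    by rewrite !mul_row_col !mul1mx !mul0mx addr0 add0r.
  have in1 := submx_trans (submxMr p1 u1) wU1;
    have in2 := submx_trans (submxMr p2 u2) wU2.
  (* The two images cancel, and one lies in [U1], the other in [U2], so both vanish. *)
  have z1 : u *m q1 *m p1 = 0.
    apply/eqP; rewrite -submx0 -capU sub_capmx in1 /= -(addrK (u *m q2 *m p2) (u *m q1 *m p1)).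
    by rewrite sum0 sub0r eqmx_opp.
  have z2 : u *m q2 *m p2 = 0 by rewrite z1 add0r in sum0.
  rewrite row_spanU -(qi _ u); apply: addmx_sub_adds; rewrite ?span_inl ?span_inr;
    apply: submxMr.
    by rewrite (eqmxP ker1) sub_capmx u1; apply/sub_kermxP.
  by rewrite (eqmxP ker2) sub_capmx u2; apply/sub_kermxP.
- apply: (@cdd_le_sum _ _ _ _ (inl @: setT)); rewrite ?subsetT // ?TD /=.
  + rewrite TU row_spanU mxrank_disjoint_sum //; apply/eqP; rewrite -submx0;
    apply/rV_subP=> u.
    rewrite sub_capmx span_inl span_inr => /andP [/submxP [x ->]] /submxP [y].
    move/(congr1 (mulmx^~ q1)); rewrite /= -!mulmxA iq1 mulmx1.
    have ->: i2 *m q1 = 0 by rewrite mul_row_col mulmx0 mul0mx add0r.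
    by rewrite !mulmx0 mulmxA => ->; rewrite mul0mx sub0mx.
  + by apply: cdd_le_imset le1 => [? ? []|].
  + by apply: cdd_le_imset le2 => [? ? []|].
Qed.

End BoundedLift.

(** * Moving vectors by elements of a subspace *)

Section Perturbation.
Variables (F : fieldType) (E : finType) (n : nat).
Implicit Types (v : E -> 'rV[F]_n) (S : {set E}) (U K : 'M[F]_n).

(* In the lift of [v] one coordinate is added to the lift of [v']: contracting
   the new unit vector gives back the lift of [v'], and the vector [c], which
   is deleted first, accounts for the new relations in the kernel. *)
Lemma bounded_lift_shift v v' S U k (a : E -> 'rV[F]_1) (q : 'rV[F]_n) :
  (q <= U)%MS -> (forall e, e \in S -> v e = v' e + a e *m q) ->
  bounded_lift v' S U k -> bounded_lift v S U k.+2.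
Proof.
move=> qU vE [A m w' p' f C inj_f dis wfp wU ker_p le_w'].
pose p : 'M[F]_(m + 1, n) := col_mx p' q.
pose i1 : 'M[F]_(m, m + 1) := row_mx 1%:M 0.
pose i2 : 'rV[F]_(m + 1) := row_mx 0 1%:M.
pose q1 : 'M[F]_(m + 1, m) := col_mx 1%:M 0.
pose q2 : 'cV[F]_(m + 1) := col_mx 0 1%:M.
have qi (u : 'rV_(m + 1)) : u *m q1 *m i1 + u *m q2 *m i2 = u.
  rewrite -[u]hsubmxK !mul_row_col !mulmx1 !mulmx0 addr0 add0r.
  by rewrite !mul_mx_row !mulmx1 !mulmx0 add_row_mx addr0 add0r.
have i1p : i1 *m p = p' by rewrite mul_row_col mul1mx mul0mx addr0.
have i2p : i2 *m p = q by rewrite mul_row_col mul1mx mul0mx add0r.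
have pE (u : 'rV_(m + 1)) : u *m p = u *m q1 *m p' + u *m q2 *m q.
  by rewrite -{1}(qi u) mulmxDl -!mulmxA i1p i2p.
(* If [q] is an image of the old span, [c] cancels the new unit vector against a preimage of [q] and
   corrects every kernel vector; otherwise no kernel vector has a nonzero new coordinate and [c = 0]
   works. *)
have [c [c_span c_ker c_red]] : exists c : 'rV[F]_(m + 1),
    [/\ (c *m q1 <= row_span w' setT)%MS, c *m p = 0 &
      forall u : 'rV_(m + 1), (u *m q1 <= row_span w' setT)%MS -> u *m p = 0 ->
        exists t : 'M_1, (u - t *m c) *m q2 = 0].
  have [/submxP [D qD]|nq] := boolP (q <= row_span w' setT *m p')%MS.
    exists (row_mx (- (D *m row_span w' setT)) 1%:M); split.
    - by rewrite mul_row_col mulmx1 mulmx0 addr0 eqmx_opp submxMl.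
    - by rewrite mul_row_col mul1mx mulNmx -mulmxA -qD addNr.
    - move=> u _ _; exists (u *m q2).
      by rewrite mulmxBl -!mulmxA [row_mx _ _ *m _]mul_row_col mulmx0 add0r !mulmx1 subrr.
  exists 0; split; rewrite ?mul0mx ?sub0mx // => u u1 up; exists 0.
  rewrite mul0mx subr0; apply/eqP; apply: contraR nq => u2.
  have q2E : u *m q2 = ((u *m q2) 0 0)%:M by apply: mx11_scalar.
  have s0 : (u *m q2) 0 0 != 0.
    by apply: contraNneq u2 => s0; rewrite q2E s0 raddf0.
  move: up; rewrite pE q2E mul_scalar_mx => /eqP; rewrite addr_eq0 => /eqP up.
  rewrite -(eqmx_scale _ s0) -eqmx_opp -up; exact: submxMr.
(* The coefficients [a] are carried over to [A] along [f], with value 0 off [f @: S]; thus the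
   vectors in [C] get new coordinate 0. *)
pose b x := if [pick e in S | f e == x] is Some e then a e else 0.
have b_f e : e \in S -> b (f e) = a e.
  rewrite /b => eS; case: pickP => [e' /andP [e'S /eqP eqf]|/(_ e)];
    last by rewrite eS eqxx.
  by rewrite (inj_f _ _ e'S eS eqf).
have b_C x : x \in C -> b x = 0.
  move=> xC; rewrite /b; case: pickP => // e /andP [eS /eqP fe].
  by have /disjointFr/(_ (imset_f f eS)) := dis; rewrite fe xC.
pose w (x : option (option A)) : 'rV[F]_(m + 1) :=
  match x with
  | Some (Some x) => row_mx (w' x) (b x) | Some None => i2 | None => c end.
pose h (x : A) := Some (Some x).
have inj_h : injective h by move=> x y [].
have wq1 x : w (h x) *m q1 = w' x by rewrite mul_row_col mulmx1 mulmx0 addr0.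
have i2q1 : i2 *m q1 = 0 by rewrite mul_row_col mulmx0 mul0mx addr0.
have sq1 : (row_span w setT *m q1 <= row_span w' setT)%MS.
  rewrite -row_spanM; apply/row_span_subP=> [[[x|]|]] _ //=.
    by rewrite (wq1 x) mem_row_span ?inE.
  by rewrite i2q1 sub0mx.
have w_C x : x \in C -> w (h x) = w' x *m i1.
  by move=> xC; rewrite /w /h b_C // mul_mx_row mulmx1 mulmx0.
have C_ker x : x \in C -> w' x *m p' = 0.
  move=> xC; apply/sub_kermxP; apply: submx_trans (mem_row_span w' xC) _.
  by rewrite (eqmxP ker_p); apply: capmxSr.
apply: (@BoundedLift _ _ _ _ _ _ _ _ _ w p (h \o f) (None |: h @: C)).
- by move=> x y xS yS /= /inj_h; apply: inj_f.
- rewrite disjoints_subset; apply/subsetP=> _ /imsetP [e eS ->]; rewrite !inE /=.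
  by rewrite mem_imset // (disjointFr dis) // imset_f.
- by move=> e eS; rewrite /= mul_row_col b_f // wfp // vE.
- rewrite -row_spanM; apply/row_span_subP=> [[[x|]|]] _ /=; last by rewrite c_ker sub0mx.
    rewrite mul_row_col addmx_sub //; last exact: mulmx_sub.
    by apply: submx_trans wU; apply: submxMr; rewrite mem_row_span ?inE.
  by rewrite i2p.
- apply/andP; split.
    rewrite sub_capmx row_spanS ?subsetT //=; apply/sub_kermxP/eqP.
    rewrite -submx0 -row_spanM; apply/row_span_subP=> x /setU1P [->|/imsetP [y yC ->]].
      by rewrite /= c_ker sub0mx.
    by rewrite w_C // -mulmxA i1p C_ker ?sub0mx.
  apply/rV_subP=> u; rewrite sub_capmx => /andP [uw /sub_kermxP up].
  have u1 : (u *m q1 <= row_span w' setT)%MS by apply: submx_trans sq1; apply: submxMr.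
  have [t ut] := c_red _ u1 up; set x := u - t *m c in ut.
  have x1 : (x *m q1 <= row_span w' setT)%MS.
    by rewrite mulmxBl addmx_sub // eqmx_opp -mulmxA mulmx_sub.
  have xp : x *m q1 *m p' = 0.
    have : x *m p = 0 by rewrite mulmxBl up -mulmxA c_ker mulmx0 subr0.
    by rewrite pE ut mul0mx addr0.
  have -> : u = x + t *m c by rewrite subrK.
  rewrite addmx_sub //; last first.
    by apply: mulmx_sub; apply: (@mem_row_span _ _ _ w _ None); rewrite !inE.
  rewrite -(qi x) ut mul0mx addr0.
  apply: (@submx_trans _ _ _ _ _ _ (row_span w' C *m i1)).
    by apply: submxMr; rewrite (eqmxP ker_p) sub_capmx x1; apply/sub_kermxP.
  rewrite -row_spanM; apply/row_span_subP=> y yC; rewrite -w_C // mem_row_span //.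
  by rewrite !inE imset_f ?orbT.
(* [None] carries [c] and is deleted; [Some None] carries the new unit vector, and contracting it
   projects the new coordinate away, which leaves [w']. *)
- apply: (@cdd_le_del _ _ _ _ None); first by rewrite inE.
  apply: (@cdd_le_con _ _ _ _ (Some None)); first by rewrite !inE.
  have -> : [set: option (option A)] :\ None :\ Some None = h @: setT.
    apply/setP=> [[[x|]|]]; rewrite !inE /=.
    + by rewrite mem_imset ?inE.
    + by apply/esym/negbTE/imsetP=> [[]].
    + by apply/esym/negbTE/imsetP=> [[]].
  apply: (cdd_le_imset inj_h _ le_w') => X _; rewrite /contract /=.
  rewrite (@row_span_rank_contract _ _ _ _ _ _ _ q1).
    rewrite row_span_imset (@eq_row_span _ _ _ _ w') // => x _; exact: wq1.
  apply/andP; split.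
    rewrite sub_capmx row_spanS ?subsetUr //= row_span1; exact/sub_kermxP.
  apply/rV_subP=> u; rewrite sub_capmx => /andP [_ /sub_kermxP u1].
  by rewrite row_span1 -(qi u) u1 mul0mx add0r submxMl.
Qed.

(** The differences are written in a row basis of [K], and each of its [\rank K] vectors is handled
    by [bounded_lift_shift] at a cost of two. *)
Lemma bounded_lift_perturb v v' S U K k :
  (K <= U)%MS -> (forall e, e \in S -> (v e - v' e <= K)%MS) ->
  bounded_lift v' S U k -> bounded_lift v S U (k + 2 * \rank K)%N.
Proof.
move=> KU vK le_v'.
suff rows t (B : 'M_(t, n)) (a : E -> 'rV_t) (u : E -> 'rV_n) : (B <= U)%MS ->
    (forall e, e \in S -> u e = v' e + a e *m B) -> bounded_lift u S U (k + 2 * t)%N.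
  apply: (rows _ (row_base K) (fun e => (v e - v' e) *m pinvmx (row_base K))).
    by rewrite eq_row_base.
  by move=> e /vK vKe; rewrite mulmxKpV ?eq_row_base // addrC subrK.
elim: t B a u => [|t IHt] B a u BU uE.
  rewrite muln0 addn0; case: le_v' => A m w p f C inj_f dis wfp wU ker_p le_w.
  apply: (BoundedLift inj_f dis _ wU ker_p le_w) => e eS.
  by rewrite wfp // uE // [a e]thinmx0 mul0mx addr0.
have -> : (k + 2 * t.+1 = (k + 2 * t).+2)%N by lia.
move: B a BU uE; rewrite -(add1n t) => B a.
rewrite -[B]vsubmxK col_mx_sub => /andP [uU dU] uE.
apply: (@bounded_lift_shift _ (fun e => v' e + rsubmx (a e) *m dsubmx B)
  _ _ _ (fun e => lsubmx (a e)) (usubmx B)) => // [e eS|].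
  by rewrite uE // -{1}[a e]hsubmxK mul_row_col [lsubmx _ *m _ + _]addrC addrA.
by apply: (IHt (dsubmx B) (fun e => rsubmx (a e))).
Qed.

End Perturbation.

(** * Subspaces of bounded connectivity *)

Notation unions Xs := (\bigcup_(X <- Xs) X).

(** Bipartitions are built part by part, to match the greedy choice in [independent_mod_exists];
    [lam_split_union] relates them to the index sets in [lamstar]. *)
Inductive split_union (E : finType) : seq {set E} -> {set E} -> {set E} -> Prop :=
| split_nil : split_union [::] set0 set0
| split_left X Xs A B : split_union Xs A B -> split_union (X :: Xs) (X :|: A) B
| split_right X Xs A B : split_union Xs A B -> split_union (X :: Xs) A (X :|: B).

Lemma split_union_bigcup (E : finType) (Xs : seq {set E}) A B :
  split_union Xs A B -> exists p : pred nat,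
    A = \bigcup_(i < size Xs | p i) nth set0 Xs i /\
    B = \bigcup_(i < size Xs | ~~ p i) nth set0 Xs i.
Proof.
have recl (Y : {set E}) Ys (p : pred nat) : \bigcup_(i < size (Y :: Ys) | p i) nth set0 (Y :: Ys) i =
    (if p 0%N then Y else set0) :|: \bigcup_(i < size Ys | p i.+1) nth set0 Ys i.
  by rewrite big_mkcond big_ord_recl /= [in RHS]big_mkcond.
elim=> {Xs A B} [|X Xs A B _ [p [-> ->]]|X Xs A B _ [p [-> ->]]].
- by exists predT; rewrite !big_ord0.
- pose p' i := if i is j.+1 then p j else true; exists p'.
  by rewrite (recl X Xs p') (recl X Xs (predC p')) /= set0U.
- pose p' i := if i is j.+1 then p j else false; exists p'.
  by rewrite (recl X Xs p') (recl X Xs (predC p')) /= set0U.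
Qed.

Lemma lam_split_union (E : finType) (M : matroid E) Xs A B :
  split_union Xs A B -> (lam M A B <= lamstar M Xs)%N.
Proof.
case/split_union_bigcup=> p [-> ->].
apply: leq_trans (leq_bigmax [set i : 'I_(size Xs) | p i]).
by rewrite leq_eqVlt; apply/orP; left; apply/eqP; congr (lam M _ _);
  apply: eq_bigl => i; rewrite !inE.
Qed.

Lemma unions_split_union (E : finType) (Xs : seq {set E}) A B :
  split_union Xs A B -> A :|: B = unions Xs.
Proof.
elim=> {Xs A B} [|X Xs A B _ IH|X Xs A B _ IH]; rewrite ?big_nil ?setU0 // big_cons -IH.
  by rewrite setUA.
by rewrite setUCA.
Qed.

Section Modular.
Variables (F : fieldType) (E : finType) (n : nat).
Implicit Types (v : E -> 'rV[F]_n) (X Y : {set E}) (Xs : seq {set E}) (K : 'M[F]_n).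

(** Each part is compared with the later ones only; for [K = 0] this says that the spans of the
    parts form a direct sum. *)
Fixpoint independent_mod v K Xs : bool :=
  if Xs is X :: Xs' then
    (row_span v X :&: row_span v (unions Xs') <= K)%MS && independent_mod v K Xs'
  else true.

Lemma independent_mod_sub v K K' Xs :
  (K <= K')%MS -> independent_mod v K Xs -> independent_mod v K' Xs.
Proof.
by move=> sK; elim: Xs => //= X Xs IH /andP [h /IH ->]; rewrite (submx_trans h sK).
Qed.

Lemma eq_independent_mod v v' K Xs :
  {in unions Xs, v =1 v'} -> independent_mod v K Xs = independent_mod v' K Xs.
Proof.
elim: Xs => //= X Xs IH; rewrite big_cons => eqv.
rewrite IH; last by move=> e eX; apply: eqv; rewrite inE eX orbT.
congr (_ && _); congr (_ :&: _ <= _)%MS; apply: eq_row_span => e eX; apply: eqv;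
  by rewrite inE eX ?orbT.
Qed.

(** If [u = a + b] is in [W], with [a] in [A] and [b] in [B], then [b = u - a] lies in [W + A] and
    [a = u - b] in [W + B]. *)
Lemma cap_adds_sub (A B W : 'M[F]_n) :
  (W :&: (A + B) <= (W + A) :&: B + A :&: (W + B))%MS.
Proof.
apply/rV_subP=> u; rewrite sub_capmx => /andP [uW /sub_addsmxP [[a b] /= uE]].
have -> : u = b *m B + a *m A by rewrite uE addrC.
have bE : b *m B = u - a *m A by rewrite uE addrAC subrr add0r.
have aE : a *m A = u - b *m B by rewrite uE addrK.
apply: addmx_sub_adds; rewrite sub_capmx submxMl ?andbT /=.
  by rewrite bE addmx_sub_adds // eqmx_opp submxMl.
by rewrite aE addmx_sub_adds // eqmx_opp submxMl.
Qed.

(* The parts are put one after the other on the side of the bipartition where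
   this increases the connectivity [\rank (A :&: B)] more; by [cap_adds_sub],
   adding the increments for both sides to [K] keeps the parts independent
   modulo [K]. *)
Lemma independent_mod_exists v Xs : exists A B K,
  [/\ split_union Xs A B,
      (row_span v A :&: row_span v B <= K)%MS,
      (K <= row_span v (unions Xs))%MS,
      (\rank K <= 2 * \rank (row_span v A :&: row_span v B)%MS)%N
    & independent_mod v K Xs].
Proof.
elim: Xs => [|X Xs [A [B [K [spl capK KU leK indK]]]]].
  exists set0, set0, 0; split; rewrite ?row_span0 ?cap0mx ?sub0mx ?mxrank0 //.
  exact: split_nil.
set a := row_span v A in capK leK *; set b := row_span v B in capK leK *.
set x := row_span v X.
have ab : (row_span v (unions Xs) :=: a + b)%MS.
  by rewrite -(unions_split_union spl); apply: row_spanU.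
pose P1 := ((x + a) :&: b)%MS; pose P2 := (a :&: (x + b))%MS.
have s1 : (a :&: b <= P1)%MS by rewrite capmxS ?addsmxSr.
have s2 : (a :&: b <= P2)%MS by rewrite capmxS ?addsmxSr.
pose K' := (K + (P1 + P2))%MS.
(* Both sums defining [K'] overlap at least in [a :&: b], since [K], [P1] and [P2] all contain it.
   With the bound on [\rank K] this leaves at most [\rank P1 + \rank P2], twice the larger of the
   two. *)
have rK' : (\rank K' + 2 * \rank (a :&: b)%MS <= \rank K + \rank P1 + \rank P2)%N.
  have r1 := mxrank_sum_cap P1 P2; have r2 := mxrank_sum_cap K (P1 + P2)%MS.
  have s12 : (a :&: b <= P1 :&: P2)%MS by rewrite sub_capmx s1.
  have sK12 : (a :&: b <= K :&: (P1 + P2))%MS.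
    by rewrite sub_capmx capK (submx_trans s1) ?addsmxSl.
  have := mxrankS s12; have := mxrankS sK12; rewrite /K'; lia.
have K'U : (K' <= row_span v (unions (X :: Xs)))%MS.
  have xab : (row_span v (unions (X :: Xs)) :=: x + (a + b))%MS.
    by rewrite big_cons; apply: eqmx_trans (row_spanU _ _ _) _; apply: adds_eqmx.
  rewrite xab /K' !addsmx_sub (submx_trans KU) ?ab ?addsmxSr //=.
  apply/andP; split.
    apply: submx_trans (capmxSr _ _) _; apply: submx_trans (addsmxSr x _).
    exact: addsmxSr.
  apply: submx_trans (capmxSl _ _) _; apply: submx_trans (addsmxSr x _).
  exact: addsmxSl.
have indK' : independent_mod v K' (X :: Xs).
  rewrite /= (independent_mod_sub _ indK) ?addsmxSl // andbT.
  apply: submx_trans (addsmxSr _ _).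
  by apply: submx_trans (cap_adds_sub a b x); rewrite capmxS ?ab.
have [le12|lt21] := leqP (\rank P2) (\rank P1).
  have eP : (row_span v (X :|: A) :&: row_span v B :=: P1)%MS.
    by apply: cap_eqmx => //; apply: row_spanU.
  exists (X :|: A), B, K'; split=> //; first exact: split_left.
    by rewrite eP; apply: submx_trans (addsmxSl _ _) (addsmxSr _ _).
  rewrite eP; lia.
have eP : (row_span v A :&: row_span v (X :|: B) :=: P2)%MS.
  by apply: cap_eqmx => //; apply: row_spanU.
exists A, (X :|: B), K'; split=> //; first exact: split_right.
  by rewrite eP; apply: submx_trans (addsmxSr _ _) (addsmxSr _ _).
rewrite eP; lia.
Qed.

Definition disjoint_parts Xs := pairwise (fun X Y : {set E} => [disjoint X & Y]) Xs.

Lemma disjoint_parts_cons X Xs :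
  disjoint_parts (X :: Xs) -> [disjoint X & unions Xs] /\ disjoint_parts Xs.
Proof.
case/andP=> dX dXs; split=> //; elim: Xs dX {dXs} => [|Y Xs IH] /=.
  by rewrite big_nil disjoint_sym disjoints_subset sub0set.
by case/andP=> dY /IH; rewrite big_cons !disjoints_subset setCU subsetI -!disjoints_subset dY.
Qed.

Lemma mem_unions Xs X e : X \in Xs -> e \in X -> e \in unions Xs.
Proof.
elim: Xs => // Y Xs IH; rewrite big_cons !inE => /predU1P [<- ->//|XXs eX].
by rewrite IH ?orbT.
Qed.

(** From the last part backwards, each span [x] is projected along [x :&: y] onto [x :\: y], where
    [y] is the original span of the later parts. The straightened later vectors stay inside [y], so
    the new part is independent of them. The linear map [Q] of each part is kept to control
    connectivity inside the part. *)
Lemma straighten v K Xs :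
  disjoint_parts Xs -> independent_mod v K Xs -> exists v' : E -> 'rV[F]_n,
  [/\ forall e, e \in unions Xs -> (v e - v' e <= K)%MS,
      (row_span v' (unions Xs) <= row_span v (unions Xs))%MS,
      independent_mod v' 0 Xs
    & forall X, X \in Xs -> exists2 Q : 'M[F]_n,
        {in X, forall e, v' e = v e *m Q} & (row_span v X :&: kermx Q <= K)%MS].
Proof.
elim: Xs => [|X Xs IH].
  by move=> _ _; exists v; split=> // e; rewrite big_nil inE.
case/disjoint_parts_cons=> dX dXs /= /andP [capK /(IH dXs) [v0 [v0K v0U ind0 Q0]]].
set x := row_span v X in capK *; set y := row_span v (unions Xs) in capK v0U *.
pose P := proj_mx (x :\: y)%MS (x :&: y)%MS.
pose P' := proj_mx (x :&: y)%MS (x :\: y)%MS.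
have cap0 : ((x :\: y) :&: (x :&: y))%MS = 0.
  apply/eqP; rewrite -submx0 -(capmx_diff x y) capmxS ?capmxSr //.
have PP' m (u : 'M_(m, n)) : (u <= x)%MS -> u *m P + u *m P' = u.
  by move=> ux; apply: add_proj_mx; rewrite ?addsmx_diff_cap_eq.
pose v' e := if e \in X then v e *m P else v0 e.
have v'X : {in X, forall e, v' e = v e *m P} by move=> e eX; rewrite /v' eX.
have v'Xs : {in unions Xs, v' =1 v0} by move=> e eXs; rewrite /v' (disjointFl dX eXs).
have spanX : (row_span v' X <= x :\: y)%MS.
  by apply/row_span_subP=> e eX; rewrite v'X //; apply: proj_mx_sub.
have spanXs : (row_span v' (unions Xs) <= y)%MS by rewrite (eq_row_span v'Xs).
exists v'; split.
- move=> e; rewrite big_cons inE => /orP [eX|eXs]; last by rewrite v'Xs // v0K.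
  rewrite v'X // -{1}(PP' _ (v e)) ?mem_row_span // addrAC subrr add0r.
  by apply: submx_trans capK; apply: proj_mx_sub.
- rewrite big_cons !row_spanU addsmxS // (submx_trans spanX) //; exact: diffmxSl.
- by rewrite (eq_independent_mod _ v'Xs) ind0 andbT -(capmx_diff x y) capmxS.
- move=> Y; rewrite inE => /predU1P [->|YXs].
    exists P => //; apply: submx_trans capK; apply/rV_subP=> u.
    rewrite sub_capmx => /andP [ux /sub_kermxP uP].
    by rewrite -(PP' _ u ux) uP add0r; apply: proj_mx_sub.
  have [Q v0Q capQ] := Q0 Y YXs; exists Q => // e eY.
  by rewrite v'Xs ?v0Q // (mem_unions YXs).
Qed.

Lemma bounded_lift_unions v Xs k : (0 < k)%N ->
  disjoint_parts Xs -> independent_mod v 0 Xs ->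
  (forall X, X \in Xs -> bounded_lift v X (row_span v X) k) ->
  bounded_lift v (unions Xs) (row_span v (unions Xs)) k.
Proof.
move=> k0; elim: Xs => [|X Xs IH] => [_ _ _|].
  by rewrite big_nil row_span0; apply: bounded_lift_set0.
case/disjoint_parts_cons=> dX dXs /= /andP [ind0 ind] le; rewrite big_cons.
apply: (@bounded_lift_weaken _ _ _ _ _ (row_span v X + row_span v (unions Xs))%MS _ k) => //.
  by rewrite row_spanU.
apply: bounded_lift_sum => //; first by apply/eqP; rewrite -submx0.
  by apply: le; rewrite inE eqxx.
by apply: IH => // Y YXs; apply: le; rewrite inE YXs orbT.
Qed.

(** Passing to [v'] lowers the ranks of [X], [Y] and [X :|: Y] by at most [\rank K] each, and only
    the drop for [X :|: Y] increases [lam]. *)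
Lemma lam_kermx_cap v v' (S : {set E}) (Q : 'M[F]_n) K X Y :
  {in S, forall e, v' e = v e *m Q} -> (row_span v S :&: kermx Q <= K)%MS ->
  X \subset S -> Y \subset S ->
  (lam (vector_matroid v') X Y <= lam (vector_matroid v) X Y + \rank K)%N.
Proof.
move=> v'Q capK sX sY.
have rankQ (Z : {set E}) : Z \subset S ->
    (\rank (row_span v' Z) + \rank (row_span v Z :&: kermx Q)%MS = \rank (row_span v Z))%N
    /\ (\rank (row_span v Z :&: kermx Q)%MS <= \rank K)%N.
  move=> sZ; rewrite (@eq_row_span _ _ _ v' (fun e => v e *m Q)); last first.
    by move=> e /(subsetP sZ)/v'Q.
  rewrite row_spanM mxrank_mul_ker; split=> //; apply: mxrankS; apply: submx_trans capK.
  by rewrite capmxS ?row_spanS.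
have sXY : X :|: Y \subset S by rewrite subUset sX.
have := rankQ _ sX; have := rankQ _ sY; have := rankQ _ sXY; rewrite /lam /=; lia.
Qed.

End Modular.

(** * Decomposition trees *)

Local Open Scope nat_scope.

Section Trees.
Variable E : finType.
Implicit Types (t u : dtree E) (ts : seq (dtree E)) (M : matroid E) (S : {set E}).

Definition parts ts : seq {set E} := [seq [set x in leaves u] | u <- ts].

Lemma depth_nth t0 ts i : i < size ts -> depth (nth t0 ts i) < depth (Node ts).
Proof.
elim: ts i => //= u ts IH [_|i /IH] /=; first by rewrite ltnS leq_maxl.
by rewrite !ltnS => h; apply: leq_trans h (leq_maxr _ _).
Qed.

Lemma unions_parts ts : unions (parts ts) = [set x in leaves (Node ts)].
Proof.
rewrite /parts /=; elim: ts => [|u ts IH] /=; first by rewrite big_nil; apply/setP=> x;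
  rewrite !inE.
by rewrite big_cons IH; apply/setP=> x; rewrite !inE mem_cat.
Qed.

Lemma mem_leaves_nth t0 ts i x :
  i < size ts -> x \in leaves (nth t0 ts i) -> x \in leaves (Node ts).
Proof.
rewrite /=; elim: ts i => //= u ts IH [_|i /IH h] /=; rewrite mem_cat; first by move->.
by move/h->; rewrite orbT.
Qed.

Lemma uniq_leaves_nth t0 ts i :
  i < size ts -> uniq (leaves (Node ts)) -> uniq (leaves (nth t0 ts i)).
Proof.
rewrite /=; elim: ts i => //= u ts IH [_|i lti];
  rewrite cat_uniq => /and3P [uu _ uts] //=.
exact: IH.
Qed.

Lemma disjoint_parts_leaves ts : uniq (leaves (Node ts)) -> disjoint_parts (parts ts).
Proof.
rewrite /= /disjoint_parts; elim: ts => //= u ts IH.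
rewrite cat_uniq => /and3P [_ /hasPn dis uts]; rewrite IH // andbT.
have {}dis : [disjoint [set x in leaves u] & unions (parts ts)].
  rewrite unions_parts disjoint_sym disjoints_subset; apply/subsetP=> x; rewrite !inE.
  exact: dis.
apply/allP=> X XP; apply: disjointWr dis; apply/subsetP=> x.
exact: mem_unions.
Qed.

Lemma lamstar_perturb M M' S q (Xs : seq {set E}) :
  (forall X Y : {set E}, X \subset S -> Y \subset S -> lam M' X Y <= lam M X Y + q) ->
  (forall X, X \in Xs -> X \subset S) -> lamstar M' Xs <= lamstar M Xs + q.
Proof.
move=> leq_lam sXs; apply/bigmax_leqP=> I _.
have sub (J : {set 'I_(size Xs)}) : \bigcup_(i in J) nth set0 Xs i \subset S.
  by apply/bigcupsP=> i _; apply: sXs; apply: mem_nth.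
apply: leq_trans (leq_lam _ _ (sub _) (sub _)) _; rewrite leq_add2r.
exact: (leq_bigmax (F := fun I : {set 'I_(size Xs)} => lam M (\bigcup_(i in I) nth set0 Xs i)
  (\bigcup_(i in ~: I) nth set0 Xs i)) I).
Qed.

Lemma good_vertices_perturb M M' S r q t :
  (forall X Y : {set E}, X \subset S -> Y \subset S -> lam M' X Y <= lam M X Y + q) ->
  {subset leaves t <= S} -> good_vertices M r t -> good_vertices M' (r + q) t.
Proof.
(* Induction on a bound for the depth, since the subtrees of a node sit in a list. *)
move=> leq_lam; move: {2}(depth t) (leqnn (depth t)) => d.
elim: d t => [|d IHd] [e|ts] // led sS; case/and3P=> ts0 le_r good_ts.
apply/and3P; split=> //.
  apply: leq_trans (lamstar_perturb leq_lam _) _; last by rewrite leq_add2r.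
  move=> X XP; apply/subsetP=> x xX; apply: sS.
  by have := mem_unions XP xX; rewrite unions_parts inE.
apply/(all_nthP (Node [::])) => i lti; apply: IHd.
- by rewrite -ltnS; apply: leq_trans (depth_nth _ lti) led.
- by move=> x /(mem_leaves_nth lti)/sS.
- by move/all_nthP: good_ts; apply.
Qed.

Lemma good_vertices_leq M r r' t :
  r <= r' -> good_vertices M r t -> good_vertices M r' t.
Proof.
move=> ler good; rewrite -(subnKC ler).
apply: (good_vertices_perturb (M := M) (S := setT)) good => [X Y _ _|x _].
  exact: leq_addr.
by rewrite inE.
Qed.

End Trees.

(** The induction varies [v] and [r]: children are treated for the straightened vectors and a larger
    width. The inequality [depth t <= d] covers children of different depths. *)
Lemma bounded_lift_tree (F : fieldType) (E : finType) n (v : E -> 'rV[F]_n) d r (t : dtree E) :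
  depth t <= d -> uniq (leaves t) -> good_vertices (vector_matroid v) r t ->
  bounded_lift v [set x in leaves t] (row_span v [set x in leaves t])
    (2 * r * (4 ^ d - 1) + 1).
Proof.
elim: d r v t => [|d IHd] r v [e|ts] // led uniq_t.
1,2: have -> : [set x in leaves (Leaf e)] = [set e] by apply/setP=> x; rewrite !inE.
1,2: by move=> _; apply: bounded_lift_set1; rewrite addn1.
case/and3P=> _ le_r good_ts.
have dis := disjoint_parts_leaves uniq_t.
have [A [B [K [spl capK KU leK indK]]]] := independent_mod_exists v (parts ts).
(* The bipartition [A], [B] is among those measured by [lamstar], so the spans of [A] and [B] meet
   in dimension at most [r]. *)
have {}leK : \rank K <= 2 * r.
  apply: leq_trans leK _; rewrite leq_mul2l /=.
  apply: leq_trans le_r; apply: leq_trans (lam_split_union _ spl).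
  by rewrite /lam /= row_spanU -mxrank_sum_cap addKn.
have [v' [v'K v'U ind0 v'Q]] := straighten dis indK.
(* Straightening raises the width to at most [r + \rank K <= 3 * r], rounded up to [4 * r] to fit
   the powers of 4. *)
have lift' : bounded_lift v' (unions (parts ts)) (row_span v' (unions (parts ts)))
    (2 * (4 * r) * (4 ^ d - 1) + 1).
  apply: bounded_lift_unions => //; first by rewrite addn1.
  move=> X XP; have [Q v'vQ capQ] := v'Q X XP.
  case/(nthP set0): XP => i; rewrite size_map => lti.
  rewrite (nth_map (Node [::])) // => eX; rewrite -eX in v'vQ capQ *.
  apply: IHd.
  - by rewrite -ltnS; apply: leq_trans (depth_nth _ lti) led.
  - exact: uniq_leaves_nth uniq_t.
  - have := (all_nthP (Node [::]) good_ts) i lti.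
    move/(good_vertices_perturb (fun X Y => @lam_kermx_cap _ _ _ _ _ _ _ _ X Y v'vQ capQ)) => good.
    apply: good_vertices_leq (good _); last by move=> x; rewrite inE.
    lia.
rewrite -unions_parts.
have := bounded_lift_perturb KU v'K (bounded_lift_weaken v'U (leqnn _) lift').
apply: bounded_lift_weaken => //.
have : 0 < 4 ^ d by rewrite expn_gt0.
rewrite expnS; nia.
Qed.

Theorem theorem4p1 (F : fieldType) (d r : nat) (E : finType) (M : matroid E) :
  representable F M -> has_rooted_decomposition M d r ->
  exists (E' : finType) (N : matroid E'),
    [/\ representable F N, minor M N & cdd N <= 2 * r * (4 ^ d - 1) + 1].
Proof.
move=> [n [v rkM]] [t [dt leaves_t good_t]].
(* Representability equates rank functions only, so the tree is transferred to the matroid of [v] as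
   a perturbation by 0. *)
have {}good_t : good_vertices (vector_matroid v) r t.
  rewrite -(addn0 r); apply: (good_vertices_perturb (S := setT)) good_t => [X Y _ _|x _].
    by rewrite addn0 /lam !rkM.
  by rewrite inE.
have uniq_t : uniq (leaves t) by rewrite (perm_uniq leaves_t) enum_uniq.
have leaves_setT : [set x in leaves t] = setT.
  by apply/setP=> x; rewrite !inE (perm_mem leaves_t) mem_enum.
have := bounded_lift_tree (eq_leq dt) uniq_t good_t.
rewrite leaves_setT => -[A m w p f C inj_f dis wfp _ /eqmxP ker_p le_w].
exists A, (vector_matroid w); split; first by exists m, w.
  exists f, C; split; first by move=> x y; apply: inj_f; rewrite inE.
  split=> // X; rewrite rkM -/(row_span v X) /=.
  rewrite (@row_span_rank_contract _ _ _ _ _ _ _ p).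
    rewrite row_span_imset (@eq_row_span _ _ _ _ v) // => e _ /=.
    by apply: wfp; rewrite inE.
  (* The kernel of [p] on the span of [f @: X :|: C] is the span of [C], because this holds on the
     span of the whole lift. *)
  apply/andP; split; rewrite ?sub_capmx ?row_spanS ?subsetUr //=.
    by rewrite ker_p capmxSr.
  by rewrite ker_p capmxS ?row_spanS ?subsetT.
exact: cdd_le_cdd.
Qed.
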